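(* Let $K$ be a positive integer, let $\boldsymbol{\mu}=(\mu_1,\dots,\mu_K)^T\in\mathbb{R}^K$ with $\mu_1\le\mu_2\le\cdots\le\mu_K$, and let $\boldsymbol{\kappa}=(\kappa_1,\dots,\kappa_K)^T\in\mathbb{R}^K$. Then the optimal value of the maximization problem $$V=\max_{\boldsymbol{\lambda}\in\Delta^K}\left(\boldsymbol{\lambda}^T\boldsymbol{\kappa}-(\boldsymbol{\lambda}^T\boldsymbol{\mu})^2\right)$$ is $$V=\max\left\{\max_{1\leq i\leq K}(\kappa_i-\mu_i^2),\ \max_{1\leq i<j\leq K}h_{ij}(\mu_{ij})\right\},$$ where, for $1\le i<j\le K$, $h_{ij}(x)=x^2-2\mu_i x+\kappa_i$ and $$\mu_{ij}=\begin{cases}\left(\mu_i\vee\dfrac{\kappa_j-\kappa_i}{2(\mu_j-\mu_i)}\right)\wedge\mu_j, & \mu_i<\mu_j,\\[2mm] \mu_i, & \mu_i=\mu_j.\end{cases}$$ Moreover, an optimal $\boldsymbol{\lambda}^*=(\lambda_1^*,\dots,\lambda_K^* )^T\in\Delta^K$ (i.e. one attaining the maximum $V$) is given as follows. If there exists $i_0$ such that $V=\kappa_{i_0}-\mu_{i_0}^2$, then an optimal $\boldsymbol{\lambda}^*$ is given by $\lambda_{i_0}^*=1$ and $\lambda_j^*=0$ for $j\ne i_0$. Otherwise, there exist $1\le i_0<j_0\le K$ such that $V=h_{i_0j_0}(\mu_{i_0j_0})$, and then an optimal $\boldsymbol{\lambda}^*$ is given by $$\lambda_{i_0}^*=\frac{\mu_{j_0}}{\mu_{j_0}-\mu_{i_0}}+\frac{\kappa_{i_0}-\kappa_{j_0}}{2(\mu_{i_0}-\mu_{j_0})^2},\qquad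 \lambda_{j_0}^*=1-\lambda_{i_0}^*,\qquad \lambda_j^*=0\ \text{ for } j\ne i_0,j_0.$$
   Context: $\Delta^K=\{\boldsymbol{\lambda}=(\lambda_1,\dots,\lambda_K)^T\in\mathbb{R}^K:\ \lambda_1+\cdots+\lambda_K=1,\ \lambda_i\ge 0,\ 1\le i\le K\}$ is the unit simplex. Notation: $a\vee b=\max\{a,b\}$, $a\wedge b=\min\{a,b\}$. A maximum over an empty index set (the case $K=1$) is taken to be $-\infty$. *)

(* Defs.v *)
From HB Require Import structures.
From mathcomp Require Import all_boot all_order all_algebra.
From mathcomp Require Import classical_sets reals ereal constructive_ereal.

Set Implicit Arguments.
Unset Strict Implicit.
Unset Printing Implicit Defensive.

Import Order.TTheory GRing.Theory Num.Theory.

Local Open Scope classical_set_scope.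
Local Open Scope ring_scope.

(* Vectors of R^K are columns: the k-th coordinate of x is x k 0. *)

Definition simplex (R : realType) (K : nat) : set 'cV[R]_K :=
  [set l | \sum_(i < K) l i 0 = 1 /\ forall i, 0 <= l i 0].

Definition objective (R : realType) (K : nat) (mu kappa l : 'cV[R]_K) : R :=
  (l^T *m kappa) 0 0 - ((l^T *m mu) 0 0) ^+ 2.

Definition is_max (R : realType) (A : set R) (v : R) : Prop :=
  A v /\ ubound A v.

Definition hfun (R : realType) (K : nat) (mu kappa : 'cV[R]_K) (i : 'I_K)
    (x : R) : R :=
  x ^+ 2 - 2 * mu i 0 * x + kappa i 0.

Definition mupair (R : realType) (K : nat) (mu kappa : 'cV[R]_K)
    (i j : 'I_K) : R :=
  if mu i 0 < mu j 0 then
    Num.min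
      (Num.max (mu i 0) ((kappa j 0 - kappa i 0) / (2 * (mu j 0 - mu i 0))))
      (mu j 0)
  else mu i 0.

(* Taken in the extended reals, so that the maximum over no pair is -oo. *)
Definition vertex_max (R : realType) (K : nat) (mu kappa : 'cV[R]_K) : \bar R :=
  \big[Order.max/-oo%E]_(i < K) (kappa i 0 - mu i 0 ^+ 2)%:E.

Definition edge_max (R : realType) (K : nat) (mu kappa : 'cV[R]_K) : \bar R :=
  \big[Order.max/-oo%E]_(i < K) \big[Order.max/-oo%E]_(j < K | (i < j)%N)
    (hfun mu kappa i (mupair mu kappa i j))%:E.

Definition optimal (R : realType) (K : nat) (mu kappa : 'cV[R]_K) (V : R)
    (l : 'cV[R]_K) : Prop :=
  simplex l /\ objective mu kappa l = V.

Definition vertex_sol (R : realType) (K : nat) (i0 : 'I_K) : 'cV[R]_K :=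
  \col_k (if k == i0 then 1 else 0).

Definition edge_weight (R : realType) (K : nat) (mu kappa : 'cV[R]_K)
    (i0 j0 : 'I_K) : R :=
  mu j0 0 / (mu j0 0 - mu i0 0)
  + (kappa i0 0 - kappa j0 0) / (2 * (mu i0 0 - mu j0 0) ^+ 2).

Definition edge_sol (R : realType) (K : nat) (mu kappa : 'cV[R]_K)
    (i0 j0 : 'I_K) : 'cV[R]_K :=
  \col_k (if k == i0 then edge_weight mu kappa i0 j0
          else if k == j0 then 1 - edge_weight mu kappa i0 j0
          else 0).

(* Main.v *)
Require Import Defs.
From mathcomp Require Import all_boot all_order all_algebra.
From mathcomp Require Import classical_sets reals ereal constructive_ereal.
From mathcomp Require Import ring lra.
Import Order.TTheory GRing.Theory Num.Theory.
Local Open Scope classical_set_scope.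
Local Open Scope ring_scope.

(** Since [- m ^+ 2] is the minimum over [x] of [x ^+ 2 - 2 * m * x], the
    problem is dual to minimizing over [x] the upper envelope of the parabolas
    [hfun i x = (x - mu i) ^+ 2 + (kappa i - mu i ^+ 2)]: a real [x] at which
    all of them are at most [V] certifies that [V] bounds the objective on the
    whole simplex ([objective_le_of_dual]).

    Let [V] be the maximum of the vertex and edge values.  The sublevel set
    [hfun i x <= V] is a closed interval centred at [mu i], nonempty because
    [V] dominates the vertex value [i].  By Helly's theorem on the line
    ([helly_intervals]) these intervals have a common point as soon as they
    meet pairwise, and for [i < j] they meet at [mupair i j]
    ([hfun_mupair_le]).

    [V] is also attained.  A vertex value is attained at its vertex.  Suppose
    that [V] is an edge value but no vertex value.  Then the clipping in
    [mupair i j] is inactive, as clipping at [mu i] gives the vertex value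
    [i], and clipping at [mu j] gives at most the vertex value [j].  So
    [mupair i j] is the abscissa where the two parabolas cross
    ([mupair_interior]), and this abscissa lies strictly between [mu i] and
    [mu j]; the weights of [edge_sol] are those for which the mean of [mu]
    equals it, and then the gap between primal and dual vanishes
    ([objective_edge_sol]). *)

(** * Finite maxima and intervals *)

(** The disjunct [-oo] accounts for maxima over no index, such as [edge_max]
    when there is a single coordinate. *)
Lemma bigmax_attained (R : realType) (I : finType) (P : pred I)
    (F : I -> \bar R) (Q : \bar R -> Prop) :
  (forall i, P i -> F i = -oo%E \/ Q (F i)) ->
  \big[Order.max/-oo%E]_(i | P i) F i = -oo%E \/
  Q (\big[Order.max/-oo%E]_(i | P i) F i).
Proof.
move=> FQ; elim/big_ind : _ => [|x y xQ yQ|//]; first by left.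
by rewrite /Order.max; case: ifP.
Qed.

(** Helly's theorem in dimension one: the largest left endpoint belongs to
    every interval. *)
Lemma helly_intervals (R : realType) (I : finType) (i0 : I) (a b : I -> R) :
  (forall i j, a i <= b j) -> exists x, forall i, a i <= x <= b i.
Proof.
move=> ab; have [m _ am] := @arg_maxP _ R I i0 predT a isT.
by exists (a m) => i; rewrite ab andbT; apply: am.
Qed.

(** * Two parabolas *)

Section Parabolas.
Variables (R : realType) (K : nat) (mu kappa : 'cV[R]_K).

Lemma hfun_vertex (i : 'I_K) :
  hfun mu kappa i (mu i 0) = kappa i 0 - mu i 0 ^+ 2.
Proof. by rewrite /hfun; ring. Qed.

Lemma hfun_le_sqrt (i : 'I_K) (V x : R) :
  kappa i 0 - mu i 0 ^+ 2 <= V ->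
  (hfun mu kappa i x <= V) =
  (mu i 0 - Num.sqrt (V - (kappa i 0 - mu i 0 ^+ 2)) <= x
   <= mu i 0 + Num.sqrt (V - (kappa i 0 - mu i 0 ^+ 2))).
Proof.
move=> vV; rewrite -ler_distl.
rewrite -[X in _ = (X <= _)]sqrtr_sqr ler_psqrt ?qualifE /= ?sqr_ge0 ?subr_ge0 //.
by rewrite /hfun; apply/idP/idP; lra.
Qed.

Definition crossing (i j : 'I_K) : R :=
  (kappa j 0 - kappa i 0) / (2 * (mu j 0 - mu i 0)).

Lemma hfun_sub (i j : 'I_K) (x : R) : mu i 0 < mu j 0 ->
  hfun mu kappa i x - hfun mu kappa j x =
  2 * (mu j 0 - mu i 0) * (x - crossing i j).
Proof.
by move=> ij; rewrite /hfun /crossing; field; rewrite subr_eq0 gt_eqF.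
Qed.

Lemma hfun_le (i j : 'I_K) (x : R) : mu i 0 < mu j 0 ->
  (hfun mu kappa i x <= hfun mu kappa j x) = (x <= crossing i j).
Proof.
move=> ij; rewrite -subr_le0 hfun_sub // pmulr_rle0 ?subr_le0 //.
by rewrite mulr_gt0 // subr_gt0.
Qed.

Lemma hfun_ge (i j : 'I_K) (x : R) : mu i 0 < mu j 0 ->
  (hfun mu kappa j x <= hfun mu kappa i x) = (crossing i j <= x).
Proof.
move=> ij; rewrite -subr_ge0 hfun_sub // pmulr_rge0 ?subr_ge0 //.
by rewrite mulr_gt0 // subr_gt0.
Qed.

Variant mupair_spec (i j : 'I_K) : R -> Prop :=
| MupairEq of mu i 0 = mu j 0 : mupair_spec i j (mu i 0)
| MupairLeft of mu i 0 < mu j 0 & crossing i j <= mu i 0 :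
    mupair_spec i j (mu i 0)
| MupairRight of mu i 0 < mu j 0 & mu j 0 <= crossing i j :
    mupair_spec i j (mu j 0)
| MupairInner of mu i 0 < crossing i j & crossing i j < mu j 0 :
    mupair_spec i j (crossing i j).

Lemma mupairP (i j : 'I_K) : mu i 0 <= mu j 0 ->
  mupair_spec i j (mupair mu kappa i j).
Proof.
rewrite /mupair -/(crossing i j) le_eqVlt => /orP[/eqP ij|ij].
  by rewrite ij ltxx -[X in mupair_spec _ _ X]ij; constructor.
rewrite ij; have [ci|ic] := leP (crossing i j) (mu i 0).
  by rewrite min_l ?ltW //; constructor.
by have [jc|cj] := leP (mu j 0) (crossing i j); constructor.
Qed.

(** The only clipped position where parabola [j] may lie above parabola [i]
    is the vertex of parabola [j], or a common abscissa of both vertices. *)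
Lemma hfun_mupair_le (i j : 'I_K) (V : R) : mu i 0 <= mu j 0 ->
  kappa j 0 - mu j 0 ^+ 2 <= V ->
  hfun mu kappa i (mupair mu kappa i j) <= V ->
  hfun mu kappa j (mupair mu kappa i j) <= V.
Proof.
move=> ij jV; case: (mupairP _ _ ij) => [-> _|lt ci|_ _ _|ic cj]; rewrite ?hfun_vertex //.
- by apply: le_trans; rewrite -hfun_vertex hfun_ge.
- by apply: le_trans; rewrite hfun_ge // (lt_trans ic).
Qed.

(** Clipping produces a vertex value, or something bounded by one. *)
Lemma mupair_interior (i j : 'I_K) : mu i 0 <= mu j 0 ->
  hfun mu kappa i (mupair mu kappa i j) <> kappa i 0 - mu i 0 ^+ 2 ->
  kappa j 0 - mu j 0 ^+ 2 < hfun mu kappa i (mupair mu kappa i j) ->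
  mupair mu kappa i j = crossing i j /\ mu i 0 < crossing i j < mu j 0.
Proof.
move=> ij; case: (mupairP _ _ ij) => [_|_ _|lt jc _|ic cj _ _].
- by rewrite hfun_vertex.
- by rewrite hfun_vertex.
- by rewrite -hfun_vertex ltNge hfun_le // jc.
- by rewrite ic.
Qed.

End Parabolas.

Arguments crossing {R K} mu kappa i j.

(** * Values of the objective *)

Section Objective.
Variables (R : realType) (K : nat) (mu kappa : 'cV[R]_K).

Lemma objectiveE (l : 'cV[R]_K) : objective mu kappa l =
  \sum_i l i 0 * kappa i 0 - (\sum_i l i 0 * mu i 0) ^+ 2.
Proof.
rewrite /objective !mxE; congr (_ - _ ^+ 2);
  by apply: eq_bigr => i _; rewrite mxE.
Qed.

(** Weak duality: the gap between the two sides is at least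
    [(x - \sum_i l i 0 * mu i 0) ^+ 2]. *)
Lemma objective_le_of_dual (x V : R) (l : 'cV[R]_K) : simplex l ->
  (forall i, hfun mu kappa i x <= V) -> objective mu kappa l <= V.
Proof.
move=> [l1 l0] hV.
have sumh : \sum_i l i 0 * hfun mu kappa i x <= V.
  rewrite -[V]mul1r -l1 mulr_suml; apply: ler_sum => i _.
  exact: ler_wpM2l.
apply: le_trans sumh; rewrite objectiveE.
have -> : \sum_i l i 0 * hfun mu kappa i x =
    x ^+ 2 - 2 * x * (\sum_i l i 0 * mu i 0) + \sum_i l i 0 * kappa i 0.
  rewrite -[X in X - _]mul1r -[in X in X - _]l1.
  rewrite mulr_suml mulr_sumr -sumrB -big_split /=.
  by apply: eq_bigr => i _; rewrite /hfun; ring.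
have := sqr_ge0 (x - \sum_i l i 0 * mu i 0); lra.
Qed.

Lemma sum_vertex_sol (i0 : 'I_K) (f : 'I_K -> R) :
  \sum_i vertex_sol R i0 i 0 * f i = f i0.
Proof.
rewrite (bigD1 i0) //= mxE eqxx mul1r big1 ?addr0 // => i ii0.
by rewrite mxE (negbTE ii0) mul0r.
Qed.

Lemma sum_edge_sol (i0 j0 : 'I_K) (f : 'I_K -> R) : i0 != j0 ->
  \sum_i edge_sol mu kappa i0 j0 i 0 * f i =
  edge_weight mu kappa i0 j0 * f i0 + (1 - edge_weight mu kappa i0 j0) * f j0.
Proof.
move=> ij; have ji : j0 != i0 by rewrite eq_sym.
rewrite (bigD1 i0) //= (bigD1 j0) //= !mxE eqxx (negbTE ji) eqxx.
rewrite big1 ?addr0 // => i /andP[ii0 ij0].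
by rewrite mxE (negbTE ii0) (negbTE ij0) mul0r.
Qed.

Lemma simplex_vertex_sol (i0 : 'I_K) : simplex (vertex_sol R i0).
Proof.
split=> [|i]; last by rewrite mxE; case: ifP.
rewrite -[RHS](sum_vertex_sol i0 (fun=> 1)).
by apply: eq_bigr => i _; rewrite mulr1.
Qed.

Lemma objective_vertex_sol (i0 : 'I_K) :
  objective mu kappa (vertex_sol R i0) = kappa i0 0 - mu i0 0 ^+ 2.
Proof. by rewrite objectiveE !sum_vertex_sol. Qed.

(** This barycentric form of the weight says that it brings the mean of [mu]
    to the crossing of the two parabolas. *)
Lemma edge_weightE (i0 j0 : 'I_K) : mu i0 0 < mu j0 0 ->
  edge_weight mu kappa i0 j0 =
  (mu j0 0 - crossing mu kappa i0 j0) / (mu j0 0 - mu i0 0).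
Proof.
move=> ij; rewrite /edge_weight /crossing; field.
by rewrite !subr_eq0 (gt_eqF ij) (lt_eqF ij).
Qed.

Lemma simplex_edge_sol (i0 j0 : 'I_K) :
  mu i0 0 < crossing mu kappa i0 j0 < mu j0 0 ->
  simplex (edge_sol mu kappa i0 j0).
Proof.
move=> /andP[ic cj]; have lt := lt_trans ic cj.
have d0 : 0 < mu j0 0 - mu i0 0 by rewrite subr_gt0.
have ij : i0 != j0 by apply: contraTneq lt => ->; rewrite ltxx.
split=> [|i].
  transitivity (\sum_i edge_sol mu kappa i0 j0 i 0 * 1).
    by apply: eq_bigr => i _; rewrite mulr1.
  by rewrite sum_edge_sol // !mulr1 subrKC.
have w0 : 0 <= edge_weight mu kappa i0 j0.
  by rewrite edge_weightE // divr_ge0 ?ltW // subr_gt0.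
have w1 : edge_weight mu kappa i0 j0 <= 1.
  by rewrite edge_weightE // ler_pdivrMr // mul1r lerD2l lerN2 ltW.
by rewrite mxE; case: ifP => // _; case: ifP => // _; rewrite subr_ge0.
Qed.

Lemma objective_edge_sol (i0 j0 : 'I_K) : mu i0 0 < mu j0 0 ->
  objective mu kappa (edge_sol mu kappa i0 j0) =
  hfun mu kappa i0 (crossing mu kappa i0 j0).
Proof.
move=> lt; have ij : i0 != j0 by apply: contraTneq lt => ->; rewrite ltxx.
rewrite objectiveE !sum_edge_sol // edge_weightE // /hfun /crossing; field.
by rewrite subr_eq0 gt_eqF.
Qed.

End Objective.

(** * The optimal value *)

Theorem theorem4p2 (R : realType) (K : nat) (hK : (0 < K)%N)
    (mu kappa : 'cV[R]_K)
    (mu_sorted : forall i j : 'I_K, (i <= j)%N -> mu i 0 <= mu j 0) :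
  exists V : R,
    [/\ is_max [set objective mu kappa l | l in @simplex R K] V,
        V%:E = Order.max (vertex_max mu kappa) (edge_max mu kappa),
        (forall i0 : 'I_K, V = kappa i0 0 - mu i0 0 ^+ 2 ->
           optimal mu kappa V (vertex_sol R i0))
      & (~ (exists i0 : 'I_K, V = kappa i0 0 - mu i0 0 ^+ 2) ->
           (exists i0 j0 : 'I_K, (i0 < j0)%N /\
              V = hfun mu kappa i0 (mupair mu kappa i0 j0)) /\
           (forall i0 j0 : 'I_K, (i0 < j0)%N ->
              V = hfun mu kappa i0 (mupair mu kappa i0 j0) ->
              mu i0 0 != mu j0 0 /\
              optimal mu kappa V (edge_sol mu kappa i0 j0)))].
Proof.
pose v i := kappa i 0 - mu i 0 ^+ 2.
pose e i j := hfun mu kappa i (mupair mu kappa i j).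
pose i1 := Ordinal hK; pose M := Order.max (vertex_max mu kappa) (edge_max mu kappa).
have vM i : ((v i)%:E <= M)%E.
  by rewrite le_max (le_bigmax_cond _ (fun i => (v i)%:E)).
have eM (i j : 'I_K) : (i < j)%N -> ((e i j)%:E <= M)%E.
  move=> ij; rewrite le_max; apply/orP; right; rewrite /edge_max.
  apply: le_trans (le_bigmax_cond _ _ (isT : predT i)).
  exact: (le_bigmax_cond _ (fun j => (e i j)%:E)).
pose Q (x : \bar R) := (exists i, x = (v i)%:E) \/
  (exists i j : 'I_K, (i < j)%N /\ x = (e i j)%:E).
have [Moo|QM] : M = -oo%E \/ Q M.
  have vQ : vertex_max mu kappa = -oo%E \/ Q (vertex_max mu kappa).
    by apply: bigmax_attained => i _; right; left; exists i.
  have eQ : edge_max mu kappa = -oo%E \/ Q (edge_max mu kappa).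
    apply: bigmax_attained => i _; apply: bigmax_attained => j ij.
    by right; right; exists i, j.
  by rewrite /M /Order.max; case: ifP.
  by have := vM i1; rewrite Moo leeNy_eq.
have [V MV] : exists V, M = V%:E.
  by case: QM => [[i ->]|[i [j [_ ->]]]]; eexists.
have vV i : v i <= V by rewrite -lee_fin -MV.
have eV (i j : 'I_K) : (i < j)%N -> e i j <= V.
  by move=> ij; rewrite -lee_fin -MV; apply: eM.
have QV : (exists i, V = v i) \/ (exists i j : 'I_K, (i < j)%N /\ V = e i j).
  move: QM; rewrite MV => -[[i [Vi]]|[i [j [ij [Vij]]]]]; first by left; exists i.
  by right; exists i, j.
have vopt i0 : V = v i0 -> optimal mu kappa V (vertex_sol R i0).
  by move=> ->; split; [exact: simplex_vertex_sol|exact: objective_vertex_sol].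
have eopt : ~ (exists i0, V = v i0) -> forall i0 j0 : 'I_K, (i0 < j0)%N ->
    V = e i0 j0 -> mu i0 0 != mu j0 0 /\ optimal mu kappa V (edge_sol mu kappa i0 j0).
  move=> nv i0 j0 ij Ve.
  have Vn i : V <> v i by move=> Vi; apply: nv; exists i.
  have [mE /[dup] c /andP[ic cj]] : mupair mu kappa i0 j0 = crossing mu kappa i0 j0 /\
      mu i0 0 < crossing mu kappa i0 j0 < mu j0 0.
    apply: mupair_interior; first by apply: mu_sorted; exact: ltnW.
      by rewrite -[hfun _ _ _ _]Ve; apply: Vn.
    by rewrite -[hfun _ _ _ _]Ve lt_neqAle vV andbT eq_sym; apply/eqP; apply: Vn.
  have lt := lt_trans ic cj; split; first by rewrite lt_eqF.
  by split; [exact: simplex_edge_sol|rewrite objective_edge_sol // Ve /e mE].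
have [l lopt] : exists l, optimal mu kappa V l.
  have [[i Vi]|nv] := boolp.pselect (exists i, V = v i).
    by exists (vertex_sol R i); apply: vopt.
  have [//|[i [j [ij Vij]]]] := QV.
  by exists (edge_sol mu kappa i j); have [] := eopt nv i j ij Vij.
have [x xV] : exists x, forall i, hfun mu kappa i x <= V.
  pose r i := Num.sqrt (V - v i).
  have meet (i j : 'I_K) : (i < j)%N -> exists x,
      (mu i 0 - r i <= x <= mu i 0 + r i) /\ (mu j 0 - r j <= x <= mu j 0 + r j).
    move=> ij; exists (mupair mu kappa i j); rewrite -!hfun_le_sqrt ?vV //.
    split; first exact: eV.
    by apply: hfun_mupair_le; [apply: mu_sorted; exact: ltnW|exact: vV|exact: eV].
  have [i j|x xr] := helly_intervals R _ i1 (fun i => mu i 0 - r i) (fun i => mu i 0 + r i).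
    have [ij|ji|/val_inj ->] := ltngtP i j.
    - by have [x [/andP[ix _] /andP[_ xj]]] := meet i j ij; exact: le_trans xj.
    - by have [x [/andP[_ xj] /andP[ix _]]] := meet j i ji; exact: le_trans xj.
    - by have := sqrtr_ge0 (V - v j); rewrite -/(r j); lra.
  by exists x => i; rewrite hfun_le_sqrt ?vV.
exists V; split=> //.
- split; first by exists l; case: lopt.
  by move=> _ [l' l's <-]; exact: (objective_le_of_dual _ _ _ _ x).
- move=> nv; split; last exact: eopt.
  by case: QV.
Qed.
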